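(* Consider the stochastic energy exchange model with transition kernel $P^t$ and the set $\mathfrak{C}$ described in the context. For any $t>0$ there exists a constant $\kappa>0$ such that $$P^t(\mathbf{E},\cdot)\ge\kappa\,U_{\mathfrak{C}}(\cdot)\quad\text{for all }\mathbf{E}\in\mathfrak{C},$$ where $U_{\mathfrak{C}}$ is the uniform probability measure on $\mathfrak{C}$.
   Context: Fix $N\ge1$, $T_L,T_R>0$, a sufficiently large $K$ ($K\gg T_L,T_R$) and $R(a,b)=\min\{K,\sqrt{\min(a,b)}\}$. The stochastic energy exchange model is the Markov jump process $\mathbf{E}_t=(E_1(t),\dots,E_N(t))$ on $\mathbb{R}^N_+$: for $i=1,\dots,N-1$ a clock of rate $R(E_i,E_{i+1})$ on sites $i,i+1$; when it rings $(E_i,E_{i+1})\mapsto(p(E_i+E_{i+1}),(1-p)(E_i+E_{i+1}))$, $p$ uniform on $(0,1)$; a clock of rate $R(T_L,E_1)$ (resp. $R(E_N,T_R)$) with $E_1\mapsto p(E_1+X_L)$ (resp. $E_N\mapsto p(E_N+X_R)$), $X_L,X_R$ exponential with means $T_L,T_R$; all independent. $P^t$ is its transition kernel. Let $W(\mathbf{E})=\sum_iE_i$, $a_m=1-\frac{2^{m-1}-1}{2^N-1}$, and for small $\eta>0$, $V(\mathbf{E})=\sum_{m=1}^N\sum_{k=1}^{N-m+1}\big(\sum_{j=0}^{m-1}E_{k+j}\big)^{a_m\eta-1}$. $M_0,M_1>1$ are the constants fixed in the paper (for small fixed $\eta,h>0$: $M_0$ is such that $P^hV-V\le-c_0V^{\alpha}$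 on $\{V>M_0\}$, and $M_1$ is such that the induced chain on $\{V\le M_0\}$ contracts $W$ on $\{W>M_1\}$). $\mathfrak{C}=\{\mathbf{E}:V(\mathbf{E})\le M_0,\ W(\mathbf{E})\le M_1\}$. *)

(* Defs.v *)
From HB Require Import structures.
From mathcomp Require Import all_boot all_order all_algebra.
From mathcomp Require Import all_classical all_reals all_analysis.
Unset Printing Implicit Defensive.
Import Order.TTheory GRing.Theory Num.Theory.
Import numFieldNormedType.Exports.
Local Open Scope classical_set_scope.
Local Open Scope ring_scope.

Section SEEM.
Context {R : realType}.

Definition rate (K a b : R) : R := Num.min K (Num.sqrt (Num.min a b)).

(* sites are 0-based: paper's E_i is nth 0 E (i-1) *)
Definition site (E : seq R) (i : nat) : R := nth 0 E i.

Definition bulk_move (E : seq R) (i : nat) (p : R) : seq R :=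
  let s := site E i + site E i.+1 in
  set_nth 0 (set_nth 0 E i (p * s)) i.+1 ((1 - p) * s).

Definition Lam (N : nat) (K : R) : R := N.+1%:R * K.

Definition total_rate (N : nat) (TL TR K : R) (E : seq R) : R :=
  \sum_(i < N.-1) rate K (site E i) (site E i.+1)
  + rate K TL (site E 0) + rate K (site E N.-1) TR.

Definition expdens (T x : R) : R := expR (- x / T) / T.

Definition stay_prob (N : nat) (TL TR K : R) (E : seq R) : R :=
  1 - total_rate N TL TR K E / Lam N K.

Definition poisson_w (N : nat) (K t : R) (n : nat) : R :=
  expR (- (Lam N K * t)) * (Lam N K * t) ^+ n / n`!%:R.

Local Open Scope ereal_scope.

Definition jump_op (N : nat) (TL TR K : R) (f : seq R -> \bar R) (E : seq R) : \bar R :=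
  \sum_(i < N.-1) ((rate K (site E i) (site E i.+1) / Lam N K)%R%:E *
      \int[@lebesgue_measure R]_(p in `[0%R, 1%R]) f (bulk_move E i p))
  + ((rate K TL (site E 0) / Lam N K)%R%:E *
      \int[@lebesgue_measure R]_(p in `[0%R, 1%R])
        \int[@lebesgue_measure R]_(x in `[0%R, +oo[)
          ((expdens TL x)%:E * f (set_nth 0%R E 0 (p * (site E 0 + x))%R)))
  + ((rate K (site E N.-1) TR / Lam N K)%R%:E *
      \int[@lebesgue_measure R]_(p in `[0%R, 1%R])
        \int[@lebesgue_measure R]_(x in `[0%R, +oo[)
          ((expdens TR x)%:E * f (set_nth 0%R E N.-1 (p * (site E N.-1 + x))%R)))
  + ((stay_prob N TL TR K E)%:E * f E).

Definition tup_set (N : nat) (A : set (N.-tuple R)) : set (seq R) :=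
  [set tval t | t in A].

Definition Pt (N : nat) (TL TR K t : R) (E : seq R) (A : set (N.-tuple R)) : \bar R :=
  \sum_(n <oo) ((poisson_w N K t n)%:E *
      iter n (jump_op N TL TR K) (fun s => (\1_(tup_set N A) s)%:E) E).

Fixpoint iint (n : nat) (f : seq R -> \bar R) : \bar R :=
  match n with
  | 0 => f [::]
  | n'.+1 => \int[@lebesgue_measure R]_x iint n' (fun s => f (x :: s))
  end.

Definition lebN (N : nat) (A : set (N.-tuple R)) : \bar R :=
  iint N (fun s => (\1_(tup_set N A) s)%:E).

Local Close Scope ereal_scope.

Definition W (E : seq R) : R := \sum_(x <- E) x.

Definition a_m (N m : nat) : R := 1 - (2 ^+ m.-1 - 1) / (2 ^+ N - 1).

Definition V (N : nat) (eta : R) (E : seq R) : R :=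
  \sum_(1 <= m < N.+1) \sum_(1 <= k < N - m + 2)
     (\sum_(0 <= j < m) site E (k + j).-1) `^ (a_m N m * eta - 1).

Definition frakC (N : nat) (eta M0 M1 : R) : set (N.-tuple R) :=
  [set E | (forall i, (i < N)%N -> 0 < site E i) /\ V N eta E <= M0 /\ W E <= M1].

Definition unifC (N : nat) (eta M0 M1 : R) (A : set (N.-tuple R)) : \bar R :=
  (lebN N (A `&` frakC N eta M0 M1) * ((fine (lebN N (frakC N eta M0 M1)))^-1)%:E)%E.

End SEEM.

(* Main.v *)
(** It suffices to bound one term of the Poisson series from below, i.e. to find
    [n] and [c > 0] with [c * \int_([a, b]^N) f <= J^n f E] for [E] in a box
    [[a, b]^N] containing the set [frakC], where [J] is the jump operator.

    This is proved for the last [k] sites by induction on [k], the other sites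
    being left unchanged. For [k = 1], one exchange with the right bath replaces
    the energy [E] by [p(E + X)], whose density on [[a, b]] is bounded below.
    For [k + 1], first redraw the last [k] sites in the larger interval
    [[a, 3b]], keeping only the event that the leftmost redrawn site [y] lies in
    [[b, 2b]]; then an exchange between [y] and its left neighbour [x] can send
    [x] to any [z] in [[a, b]], because the remainder [x + y - z] stays in
    [[a, 3b]]; finally redraw the last [k] sites again.

    The new site is always integrated outermost, which is the order of
    integration in [iint], and only affine changes of one variable occur. Hence
    neither Fubini nor the measurability of partial integrals is needed: the
    integral of a nonnegative function is a supremum over simple functions, and
    the inequalities on integrals reduce to those. *)
Require Import Defs.
From HB Require Import structures.
From mathcomp Require Import all_boot all_order all_algebra.
From mathcomp Require Import all_classical all_reals all_analysis.
From mathcomp Require Import measurable_realfun ring lra.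
Import Order.TTheory GRing.Theory Num.Theory.
Local Open Scope classical_set_scope.
Local Open Scope ring_scope.

(** * Integrals of nonnegative functions as suprema, and affine changes of variable *)

Section lower_integral.
Context {R : realType}.
Implicit Types (D : set R) (f g : R -> \bar R).
Local Notation mu := (@lebesgue_measure R).
Local Open Scope ereal_scope.
Import HBNNSimple.

Lemma ge0_integral_lub D f y : (forall x, D x -> 0 <= f x) ->
  (forall h : {nnsfun measurableTypeR R >-> R},
    (forall x, (h x)%:E <= (f \_ D) x) -> \int[mu]_x (h x)%:E <= y) ->
  \int[mu]_(x in D) f x <= y.
Proof.
move=> f0 H; rewrite ge0_integralE//; apply: ge_ereal_sup => _ [h/= hf <-].
by rewrite -integralT_nnsfun; exact: H.
Qed.

(** Every simple function below [f \_ D1] is below [g \_ D2], so the first supremum runs over a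
    smaller set. Integrand and domain may change together. *)
Lemma ge0_le_integral_patch D1 D2 f g :
  (forall x, D1 x -> 0 <= f x) -> (forall x, D2 x -> 0 <= g x) ->
  (forall x, (f \_ D1) x <= (g \_ D2) x) ->
  \int[mu]_(x in D1) f x <= \int[mu]_(x in D2) g x.
Proof.
move=> f0 g0 fg; rewrite !ge0_integralE//; apply: ge_ereal_sup => _ [h/= hf <-].
by apply: ereal_sup_ubound; exists h => //= x; exact: le_trans (hf x) (fg x).
Qed.

Lemma nonneg_le_integral D f g : (forall x, D x -> 0 <= f x) ->
  (forall x, D x -> f x <= g x) ->
  \int[mu]_(x in D) f x <= \int[mu]_(x in D) g x.
Proof.
move=> f0 fg; apply: ge0_le_integral_patch => // x.
  by move=> Dx; exact: le_trans (f0 _ Dx) (fg _ Dx).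
by rewrite /patch; case: ifPn => // /set_mem /fg.
Qed.

Lemma le_integral_subset D1 D2 f : (forall x, D2 x -> 0 <= f x) ->
  D1 `<=` D2 -> \int[mu]_(x in D1) f x <= \int[mu]_(x in D2) f x.
Proof.
move=> f0 D12; apply: ge0_le_integral_patch => // [x /D12 /f0//|x].
rewrite /patch; case: ifPn => [/set_mem/D12/mem_set ->//|_].
by case: ifPn => // /set_mem /f0.
Qed.

(** A simple [h] below [f] is measurable, so [c] passes through its integral, and [c * h] lies below
    [c * f]. *)
Lemma le_integralZl D (c : R) f : (0 <= c)%R -> (forall x, D x -> 0 <= f x) ->
  c%:E * \int[mu]_(x in D) f x <= \int[mu]_(x in D) (c%:E * f x).
Proof.
rewrite le_eqVlt => /orP[/eqP <- f0|c0 f0].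
  by rewrite mul0e integral_ge0// => x _; rewrite mul0e.
rewrite -lee_pdivlMl//; apply: ge0_integral_lub => // h hf.
rewrite lee_pdivlMl//.
rewrite -ge0_integralZl_EFin//; last 3 first.
- by move=> x _; rewrite lee_fin.
- exact/measurable_EFinP.
- exact: ltW.
apply: ge0_le_integral_patch => [x _|x Dx|x].
- by rewrite mule_ge0 ?lee_fin// ltW.
- by rewrite mule_ge0 ?lee_fin ?f0// ltW.
- rewrite patch_setT; have := hf x; rewrite /patch; case: ifPn => _ hx.
    by rewrite lee_wpmul2l// lee_fin ltW.
  by rewrite (le_trans (lee_wpmul2l _ hx)) ?mule0// lee_fin ltW.
Qed.

Definition affine (s r x : R) : R := (s * x + r)%R.

Lemma measurable_affine s r :
  @measurable_fun _ _ (measurableTypeR R) (measurableTypeR R) setT (affine s r).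
Proof. by apply: measurable_funD => //; exact: measurable_funM. Qed.

(** The right-hand side is a measure in [A] that gives half-open intervals their length, so
    uniqueness of Lebesgue measure applies. *)
Lemma lebesgue_measure_affine s r (s0 : (0 < s)%R) A : measurable A ->
  mu A = s%:E * mu (affine s r @^-1` A).
Proof.
pose push : {measure set (measurableTypeR R) -> \bar R} :=
  pushforward mu (affine s r : measurableTypeR R -> measurableTypeR R).
pose nu : {measure set (measurableTypeR R) -> \bar R} :=
  mscale (NngNum (ltW s0)) (push (measurable_affine s r)).
move=> mA; rewrite (@lebesgue_measure_unique R nu)//.
move=> X /ocitvP[->|[[a b] /= ab ->]]; first by rewrite !measure0.
rewrite /nu /mscale/= /pushforward/=.
rewrite (_ : _ @^-1` _ = `](a - r) / s, (b - r) / s]%classic)%R; last first.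
  apply/seteqP; split => x /=; rewrite /affine !in_itv/=.
    by rewrite ltr_pdivrMr// ler_pdivlMr// ltrBlDr lerBrDr (mulrC x).
  by rewrite ltr_pdivrMr// ler_pdivlMr// ltrBlDr lerBrDr (mulrC x).
rewrite !lebesgue_measure_itv/= !lte_fin ab ltr_pM2r ?invr_gt0//.
rewrite ltrD2r ab -!EFinD -EFinM; congr EFin.
by field; rewrite gt_eqF.
Qed.

(** The change of variables is exact for each simple [h] below [g], and composing with [affine s r]
    preserves [h <= g]. *)
Lemma le_integral_affine s r g : (0 < s)%R -> (forall x, 0 <= g x) ->
  s^-1%:E * \int[mu]_x g x <= \int[mu]_x g (affine s r x).
Proof.
move=> s0 g0; rewrite lee_pdivrMl//; apply: ge0_integral_lub => // h hg.
pose push : {measure set (measurableTypeR R) -> \bar R} :=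
  pushforward mu (affine s r : measurableTypeR R -> measurableTypeR R).
pose nu : {measure set (measurableTypeR R) -> \bar R} :=
  mscale (NngNum (ltW s0)) (push (measurable_affine s r)).
have -> : \int[mu]_x (h x)%:E = \int[nu]_x (h x)%:E.
  apply: eq_measure_integral => A mA _.
  exact: (lebesgue_measure_affine _ r s0 _ mA).
rewrite ge0_integral_mscale//=; last 2 first.
- exact/measurable_EFinP.
- by move=> x _; rewrite lee_fin.
rewrite lee_pmul2l ?lte_fin// ge0_integral_pushforward//=; last 3 first.
- exact: measurable_affine.
- exact/measurable_EFinP.
- by move=> x _; rewrite lee_fin.
rewrite preimage_setT; apply: nonneg_le_integral => [x _|x _ /=].
  by rewrite /= lee_fin.
by have := hg (affine s r x); rewrite patch_setT.
Qed.

End lower_integral.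

(** * Positivity of the jump operator and lower bounds by a single summand *)

Section jump_operator.
Context {R : realType}.
Variables (N : nat) (TL TR K : R).
Hypotheses (N_gt0 : (0 < N)%N) (TL_gt0 : 0 < TL) (TR_gt0 : 0 < TR) (K_gt0 : 0 < K).
Implicit Types f g : seq R -> \bar R.
Local Notation J := (jump_op N TL TR K).

Lemma rate_ge0 a b : 0 <= rate K a b.
Proof. by rewrite le_min (ltW K_gt0) sqrtr_ge0. Qed.

Lemma Lam_gt0 : 0 < Lam N K.
Proof. by rewrite mulr_gt0// ltr0n. Qed.

Lemma rate_div_Lam_ge0 a b : 0 <= rate K a b / Lam N K.
Proof. by rewrite divr_ge0 ?rate_ge0// ltW// Lam_gt0. Qed.

Lemma rate_le a b a' b' : a <= a' -> b <= b' -> rate K a b <= rate K a' b'.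
Proof.
by move=> aa bb; rewrite /rate le_min2 ?lexx// ler_wsqrtr// le_min2.
Qed.

Lemma rate_gt0 a b : 0 < a -> 0 < b -> 0 < rate K a b.
Proof. by move=> a0 b0; rewrite lt_min K_gt0 sqrtr_gt0 lt_min a0. Qed.

(** There are [N.-1] bulk clocks and two bath clocks, each of rate at most [K], so the total rate is
    at most [Lam N K]. *)
Lemma stay_prob_ge0 E : 0 <= stay_prob N TL TR K E.
Proof.
have rK a b : rate K a b <= K by rewrite ge_min lexx.
rewrite subr_ge0 ler_pdivrMr ?Lam_gt0// mul1r /total_rate /Lam.
have -> : N.+1%:R * K = \sum_(i < N.-1) K + K + K :> R.
  rewrite sumr_const card_ord -mulr_natl.
  by case: N N_gt0 => // n _; rewrite -!natr1; ring.
by rewrite !lerD// ler_sum.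
Qed.

Lemma expdens_ge0 (T x : R) : 0 < T -> 0 <= expdens T x.
Proof. by move=> T0; rewrite divr_ge0 ?expR_ge0// ltW. Qed.

Local Open Scope ereal_scope.

Lemma bulk_term_ge0 f E i : (forall s, 0 <= f s) ->
  0 <= (rate K (site E i) (site E i.+1) / Lam N K)%:E *
      \int[@lebesgue_measure R]_(p in `[0%R, 1%R]) f (bulk_move E i p).
Proof.
by move=> f0; rewrite mule_ge0 ?lee_fin ?rate_div_Lam_ge0// integral_ge0.
Qed.

Lemma bath_term_ge0 f E i (r T : R) : (forall s, 0 <= f s) -> (0 <= r)%R -> (0 < T)%R ->
  0 <= r%:E *
      \int[@lebesgue_measure R]_(p in `[0%R, 1%R])
        \int[@lebesgue_measure R]_(x in `[0%R, +oo[)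
          ((expdens T x)%:E * f (set_nth 0%R E i (p * (site E i + x))%R)).
Proof.
move=> f0 r0 T0; rewrite mule_ge0 ?lee_fin// integral_ge0// => p _.
by rewrite integral_ge0// => x _; rewrite mule_ge0// lee_fin expdens_ge0.
Qed.

Lemma bulk_sum_ge0 f E : (forall s, 0 <= f s) ->
  0 <= \sum_(i < N.-1) ((rate K (site E i) (site E i.+1) / Lam N K)%:E *
      \int[@lebesgue_measure R]_(p in `[0%R, 1%R]) f (bulk_move E i p)).
Proof. by move=> f0; apply: sume_ge0 => i _; exact: bulk_term_ge0. Qed.

Lemma stay_term_ge0 f E : (forall s, 0 <= f s) ->
  0 <= (stay_prob N TL TR K E)%:E * f E.
Proof. by move=> f0; rewrite mule_ge0// lee_fin stay_prob_ge0. Qed.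

Lemma jump_op_ge0 f E : (forall s, 0 <= f s) -> 0 <= J f E.
Proof.
move=> f0; rewrite /jump_op !adde_ge0 ?bulk_sum_ge0 ?stay_term_ge0//.
- exact: bath_term_ge0 (rate_div_Lam_ge0 _ _) TL_gt0.
- exact: bath_term_ge0 (rate_div_Lam_ge0 _ _) TR_gt0.
Qed.

Lemma iter_jump_op_ge0 n f E : (forall s, 0 <= f s) -> 0 <= iter n J f E.
Proof.
by move=> f0; elim: n E => [|n IH] E //=; exact: jump_op_ge0.
Qed.

Lemma jump_op_ge_bulk f E i : (forall s, 0 <= f s) -> (i < N.-1)%N ->
  (rate K (site E i) (site E i.+1) / Lam N K)%:E *
      \int[@lebesgue_measure R]_(p in `[0%R, 1%R]) f (bulk_move E i p) <= J f E.
Proof.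
move=> f0 iN; rewrite /jump_op -!addeA.
rewrite (bigD1 (Ordinal iN))//= -addeA leeDl// !adde_ge0 ?stay_term_ge0//.
- by apply: sume_ge0 => j _; exact: bulk_term_ge0.
- exact: bath_term_ge0 (rate_div_Lam_ge0 _ _) TL_gt0.
- exact: bath_term_ge0 (rate_div_Lam_ge0 _ _) TR_gt0.
Qed.

Lemma jump_op_ge_right_bath f E : (forall s, 0 <= f s) ->
  (rate K (site E N.-1) TR / Lam N K)%:E *
      \int[@lebesgue_measure R]_(p in `[0%R, 1%R])
        \int[@lebesgue_measure R]_(x in `[0%R, +oo[)
          ((expdens TR x)%:E * f (set_nth 0%R E N.-1 (p * (site E N.-1 + x))%R))
  <= J f E.
Proof.
move=> f0; rewrite /jump_op -addeA addeCA leeDl// !adde_ge0 ?bulk_sum_ge0 ?stay_term_ge0//.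
exact: bath_term_ge0 (rate_div_Lam_ge0 _ _) TL_gt0.
Qed.

End jump_operator.

(** * Iterated integrals over boxes *)

Section box_integral.
Context {R : realType}.
Implicit Types (a b : R) (f g : seq R -> \bar R).
Local Notation mu := (@lebesgue_measure R).

Definition inbox a b (s : seq R) := all (fun x => a <= x <= b) s.

Lemma inboxW a b a' b' s : a' <= a -> b <= b' -> inbox a b s -> inbox a' b' s.
Proof.
move=> aa bb; apply: sub_all => x /andP[ax xb].
by rewrite (le_trans aa ax) (le_trans xb bb).
Qed.

Local Open Scope ereal_scope.

Fixpoint bint a b (n : nat) f : \bar R :=
  match n with
  | 0 => f [::]
  | n'.+1 => \int[mu]_(x in `[a, b]) bint a b n' (fun s => f (x :: s))
  end.

Lemma bint_ge0 a b n f : (forall s, 0 <= f s) -> 0 <= bint a b n f.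
Proof.
elim: n f => [|n IH] f f0 //=; apply: integral_ge0 => x _.
by apply: IH => s.
Qed.

Lemma le_bint a b n f g : (forall s, 0 <= f s) ->
  (forall s, size s = n -> inbox a b s -> f s <= g s) ->
  bint a b n f <= bint a b n g.
Proof.
elim: n f g => [|n IH] f g f0 fg /=; first exact: fg.
apply: nonneg_le_integral => [x _|x /=]; first exact: bint_ge0.
rewrite in_itv/= => axb; apply: IH => // s sn sab.
by apply: fg; rewrite /= ?sn// axb.
Qed.

Lemma bint_widen a b a' b' n f : (forall s, 0 <= f s) -> (a' <= a)%R -> (b <= b')%R ->
  bint a b n f <= bint a' b' n f.
Proof.
move=> + aa bb; elim: n f => [|n IH] f f0 //=.
apply: (@le_trans _ _ (\int[mu]_(x in `[a, b]) bint a' b' n (fun s => f (x :: s)))).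
  by apply: nonneg_le_integral => x _; [exact: bint_ge0|exact: IH].
apply: le_integral_subset => [x _|]; first exact: bint_ge0.
by apply: subset_itv; rewrite bnd_simp.
Qed.

Lemma bint_cst a b n (C : \bar R) : (a <= b)%R ->
  bint a b n (fun=> C) = C * ((b - a) ^+ n)%:E.
Proof.
move=> ab; elim: n => [|n IH] /=; first by rewrite mule1.
under eq_integral do rewrite IH.
rewrite integral_cst//= lebesgue_measure_itv/= lte_fin -muleA; congr (_ * _).
rewrite exprSr EFinM; congr (_ * _); case: ltP => //= ba.
by rewrite (_ : b = a) ?subrr//; apply/eqP; rewrite eq_le ab ba.
Qed.

Lemma iint_ge0 n f : (forall s, 0 <= f s) -> 0 <= iint n f.
Proof.
elim: n f => [|n IH] f f0 //=; apply: integral_ge0 => x _.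
by apply: IH => s.
Qed.

Lemma iint0 n : @iint R n (cst 0) = 0.
Proof. by elim: n => //= n IH; apply: integral0_eq. Qed.

(** Peel off the head coordinate: outside [[a, b]] the section of [f] is identically zero, inside it
    the induction hypothesis applies. *)
Lemma iint_le_bint a b n f g : (forall s, 0 <= f s) -> (forall s, f s <= g s) ->
  (forall s, ~~ inbox a b s -> f s = 0) -> iint n f <= bint a b n g.
Proof.
elim: n f g => [|n IH] f g f0 fg fab /=; first exact: fg.
apply: ge0_le_integral_patch => [x _|x _|x].
- exact: iint_ge0.
- by apply: bint_ge0 => s; exact: le_trans (f0 _) (fg _).
- rewrite patch_setT /patch; case: ifPn => [_|].
    apply: IH => // s sab; apply: fab; apply: contra sab => /= /andP[]//.
  rewrite notin_setE/= in_itv/= => /negP xab.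
  rewrite (_ : (fun s => f (x :: s)) = cst 0) ?iint0//.
  by apply/funext => s; apply: fab; rewrite /= negb_and xab.
Qed.

End box_integral.

(** * Minorization of iterated jumps on a box *)

Section minorization.
Context {R : realType}.
Variables (N : nat) (TL TR K : R).
Hypotheses (N_gt0 : (0 < N)%N) (TL_gt0 : 0 < TL) (TR_gt0 : 0 < TR) (K_gt0 : 0 < K).
Implicit Types (a b : R) (f g : seq R -> \bar R).
Local Notation mu := (@lebesgue_measure R).
Local Notation J := (jump_op N TL TR K).

Lemma set_nth_cat_cons (T : Type) (x0 x y : T) s1 s2 :
  set_nth x0 (s1 ++ x :: s2) (size s1) y = s1 ++ y :: s2.
Proof. by elim: s1 => //= z s1 ->. Qed.

Lemma site_cat_cons (x : R) s1 s2 : site (s1 ++ x :: s2) (size s1) = x.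
Proof. by rewrite /site nth_cat ltnn subnn. Qed.

Lemma bulk_move_cat (x y p : R) s1 s2 :
  bulk_move (s1 ++ x :: y :: s2) (size s1) p =
  s1 ++ (p * (x + y)) :: ((1 - p) * (x + y)) :: s2.
Proof.
have siteS : site (s1 ++ x :: y :: s2) (size s1).+1 = y.
  by rewrite -cat_rcons -(size_rcons s1 x) site_cat_cons.
rewrite /bulk_move site_cat_cons siteS set_nth_cat_cons -cat_rcons.
by rewrite -(size_rcons s1 (p * (x + y))) set_nth_cat_cons cat_rcons.
Qed.

Local Open Scope ereal_scope.

(** For [p] in [[a / b / 2, a / b]] one has [p * x <= a], so every [y] in [[a, b]] is [p * (x + z)]
    with [0 <= z <= 2 * b * b / a], a range on which the exponential density is at least its value
    at the right end. *)
Lemma right_bath_minorization a b : (0 < a)%R -> (a <= b)%R ->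
  exists c : R, (0 < c)%R /\ forall s x f, (size s).+1 = N -> (a <= x <= b)%R ->
    (forall s, 0 <= f s) ->
    c%:E * \int[mu]_(y in `[a, b]) f (rcons s y) <= J f (rcons s x).
Proof.
move=> a0 ab; have b0 := lt_le_trans a0 ab.
pose r := (rate K a TR / Lam N K)%R.
pose d := expdens TR (b * b / a * 2)%R.
have r0 : (0 < r)%R by rewrite divr_gt0 ?Lam_gt0 ?rate_gt0.
have d0 : (0 < d)%R by rewrite divr_gt0 ?expR_gt0.
(* The factors bound the rate and the density from below; the last one is the length of the interval
   of [p]. *)
exists (r * (d * (a / b / 2)))%R; split; first by rewrite mulr_gt0// mulr_gt0// !divr_gt0.
move=> s x f sN axb f0; set G := \int[mu]_(y in _) _.
have G0 : 0 <= G by exact: integral_ge0.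
have [ax xb] := andP axb.
apply: le_trans (jump_op_ge_right_bath _ _ _ _ N_gt0 TL_gt0 K_gt0 _ _ f0).
have -> : N.-1 = size s by rewrite -sN.
rewrite -cats1 site_cat_cons EFinM -muleA; apply: lee_pmul.
- by rewrite lee_fin ltW.
- by rewrite mule_ge0// lee_fin !mulr_ge0// ltW ?invr_gt0.
- rewrite lee_fin ler_wpM2r ?invr_ge0//; first exact/ltW/Lam_gt0.
  exact: rate_le.
pose G' p := \int[mu]_(z in `[0%R, +oo[)
  ((expdens TR z)%:E * f (set_nth 0%R (s ++ [:: x]) (size s) (p * (x + z))%R)).
have H0 (z p : R) : 0 <= (expdens TR z)%:E * f (set_nth 0%R (s ++ [:: x]) (size s) (p * (x + z))%R).
  by rewrite mule_ge0// lee_fin expdens_ge0.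
have ab0 : (0 < a / b)%R by rewrite divr_gt0.
have ab1 : (a / b <= 1)%R by rewrite ler_pdivrMr// mul1r.
have -> : (d * (a / b / 2))%:E * G = \int[mu]_(p in `[(a / b / 2)%R, (a / b)%R]) (d%:E * G).
  rewrite integral_cst//= lebesgue_measure_itv/= lte_fin gtr_pMr// invf_lt1// ltr1n.
  rewrite -EFinD EFinM -!muleA [_ * G]muleC; congr (_ * (_ * _%:E)).
  by rewrite [X in (X - _)%R](splitr (a / b)) addrK.
apply: (@le_trans _ _ (\int[mu]_(p in `[(a / b / 2)%R, (a / b)%R]) G' p)); last first.
  apply: le_integral_subset => [p _|]; first by apply: integral_ge0 => z _; exact: H0.
  by apply: subset_itv; rewrite bnd_simp// !divr_ge0// ltW.
apply: nonneg_le_integral => [p _|p /=]; first by rewrite mule_ge0// lee_fin ltW.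
rewrite in_itv/= => /andP[p1 p2].
have p0 : (0 < p)%R by rewrite (lt_le_trans _ p1)// divr_gt0.
have pi1 : (1 <= p^-1)%R by rewrite invf_ge1// (le_trans p2).
pose g := (fun y => f (rcons s y)) \_ `[a, b].
have g0 y : 0 <= g y by rewrite /g /patch; case: ifPn.
have Gg : G = \int[mu]_y g y by rewrite /G integral_mkcond.
apply: (@le_trans _ _ (d%:E * \int[mu]_z g (affine p (p * x) z))).
  rewrite lee_wpmul2l ?lee_fin ?(ltW d0)//.
  (* The substitution [y = p * (x + z)] produces the factor [p^-1], which is at least 1. *)
  apply: le_trans (le_integral_affine _ _ _ p0 g0); rewrite -Gg.
  by rewrite -[leLHS]mul1e lee_wpmul2r// lee_fin.
apply: le_trans (le_integralZl _ _ _ (ltW d0) _) _ => //.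
apply: ge0_le_integral_patch => [z _|z _|z]; [|exact: H0|].
  by rewrite mule_ge0// lee_fin ltW.
rewrite patch_setT /g {1}/patch; case: ifPn => [/set_mem/=|_]; last first.
  by rewrite mule0 /patch; case: ifPn.
rewrite in_itv/= /affine -mulrDr [(z + x)%R]addrC => /andP[az zb].
(* Here [p * x <= p * b <= a <= p * (x + z)]. *)
have z0 : (0 <= z)%R.
  rewrite -(@lerD2l _ x) addr0 (le_trans xb)// -(ler_pM2l p0) (le_trans _ az)//.
  by rewrite -ler_pdivlMr.
have zb' : (z <= b * b / a * 2)%R.
  apply: (@le_trans _ _ (x + z)%R); first by rewrite lerDr (le_trans (ltW a0)).
  rewrite -(ler_pM2l p0) (le_trans zb)//.
  apply: (@le_trans _ _ (a / b / 2 * (b * b / a * 2))%R); last first.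
    by rewrite ler_wpM2r// !mulr_ge0 ?invr_ge0// ltW.
  by rewrite le_eqVlt; apply/orP; left; apply/eqP; field; rewrite !gt_eqF.
rewrite /patch mem_set/= ?in_itv/= ?andbT// set_nth_cat_cons cats1.
rewrite lee_wpmul2r// lee_fin ler_wpM2r ?invr_ge0 ?(ltW TR_gt0)// ler_expR.
by rewrite ler_wpM2r ?invr_ge0 ?(ltW TR_gt0)// lerN2.
Qed.

(** The total [x + y] lies in [[a + b, 3 * b]]: giving [z] to the left site leaves a remainder in
    [[a, 3 * b]], and the substitution [z = p * (x + y)] produces a factor at least [1 / (3 * b)].
    The bound [c * f z] on [h] must hold for every such remainder [w]. *)
Lemma bulk_minorization a b (c : R) (s1 : seq R) (x y : R) (s2 : seq R)
    (f : R -> \bar R) (h : seq R -> \bar R) :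
  (0 < a)%R -> (a <= b)%R -> (0 <= c)%R -> (size s1 + (size s2).+2)%N = N ->
  (a <= x <= b)%R -> (b <= y <= 2 * b)%R ->
  (forall s, 0 <= h s) -> (forall z, 0 <= f z) ->
  (forall z w, (a <= z <= b)%R -> (a <= w <= 3 * b)%R ->
    c%:E * f z <= h (s1 ++ z :: w :: s2)) ->
  (rate K a a / Lam N K * (c / (3 * b)))%:E * \int[mu]_(z in `[a, b]) f z <=
  J h (s1 ++ x :: y :: s2).
Proof.
move=> a0 ab c0 sN /andP[ax xb] /andP[yb yb2] h0 f0 fh.
have b0 := lt_le_trans a0 ab.
have s1N : (size s1 < N.-1)%N by rewrite -sN !addnS ltnS leq_addr.
apply: le_trans (jump_op_ge_bulk _ _ _ _ N_gt0 TL_gt0 TR_gt0 K_gt0 _ _ _ h0 s1N).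
set G := \int[mu]_(z in _) _.
have G0 : 0 <= G by exact: integral_ge0.
have -> : site (s1 ++ x :: y :: s2) (size s1).+1 = y.
  by rewrite -cat_rcons -(size_rcons s1 x) site_cat_cons.
rewrite site_cat_cons EFinM -muleA; apply: lee_pmul.
- by rewrite lee_fin rate_div_Lam_ge0.
- by rewrite mule_ge0// lee_fin divr_ge0// mulr_ge0// ltW.
- rewrite lee_fin ler_wpM2r ?invr_ge0//; first exact/ltW/Lam_gt0.
  by apply: rate_le => //; exact: le_trans ab yb.
pose g := f \_ `[a, b].
have g0 z : 0 <= g z by rewrite /g /patch; case: ifPn.
have Gg : G = \int[mu]_z g z by rewrite /G integral_mkcond.
have t0 : (0 < x + y)%R by rewrite addr_gt0// (lt_le_trans _ ax, lt_le_trans _ yb).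
have t3 : (x + y <= 3 * b)%R by lra.
apply: (@le_trans _ _ (c%:E * \int[mu]_p g (affine (x + y) 0 p))).
  rewrite EFinM -muleA lee_wpmul2l//.
  apply: le_trans (le_integral_affine _ _ _ t0 g0); rewrite -Gg.
  by rewrite lee_wpmul2r// lee_fin lef_pV2 ?posrE ?mulr_gt0.
apply: le_trans (le_integralZl _ _ _ c0 _) _ => //.
apply: ge0_le_integral_patch => [p _|p _|p]; [by rewrite mule_ge0|exact: h0|].
rewrite patch_setT /g {1}/patch; case: ifPn => [/set_mem/=|_]; last first.
  by rewrite mule0 /patch; case: ifPn.
rewrite in_itv/= /affine addr0 => /andP[pa pb].
have p01 : (0 <= p <= 1)%R.
  rewrite -(pmulr_rge0 _ t0) (le_trans (ltW a0))//=.
  by rewrite -(ler_pM2l t0) mulr1 (le_trans pb)//; lra.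
rewrite /patch mem_set/= ?in_itv//= bulk_move_cat mulrC.
by apply: fh; rewrite mulrC ?pa//; lra.
Qed.

Lemma last_sites_minorization k a b : (0 < k)%N -> (0 < a)%R -> (a <= b)%R ->
  exists n (c : R), (0 < c)%R /\ forall s u f, (size s + k)%N = N -> size u = k ->
    inbox a b s -> inbox a b u -> (forall s, 0 <= f s) ->
    c%:E * bint a b k (fun v => f (s ++ v)) <= iter n J f (s ++ u).
Proof.
(* The bound [b] stays general because the induction hypothesis is used on [[a, 3 * b]]. *)
move=> k0 a0; elim: k k0 b => [//|[|k] IH] _ b ab.
  have [c [c0 H]] := right_bath_minorization _ _ a0 ab.
  exists 1%N, c; split => // s [//|x [|//]] f; rewrite addn1 /= => sN _ _.
  rewrite andbT => axb f0; rewrite cats1; under eq_integral do rewrite cats1.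
  exact: H.
have b0 := lt_le_trans a0 ab.
have ab3 : (a <= 3 * b)%R by lra.
have [n [c [c0 {}IH]]] := IH isT _ ab3.
pose d := (rate K a a / Lam N K * (c / (3 * b)))%R.
have d0 : (0 < d)%R by rewrite mulr_gt0// divr_gt0 ?mulr_gt0 ?rate_gt0 ?Lam_gt0.
(* Volume of the kept event: [y] in [[b, 2 * b]], the other [k] redrawn sites in [[a, 3 * b]]. *)
pose vol := ((3 * b - a) ^+ k * b)%R.
have vol0 : (0 < vol)%R by rewrite mulr_gt0// exprn_gt0//; lra.
(* Two redraws of [n] jumps each and one exchange between them. The first redraw gives [c * vol];
   [d] accounts for the exchange and the second redraw. *)
exists (n + n.+1)%N, (c * (vol * d))%R; split; first by rewrite mulr_gt0// mulr_gt0.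
move=> s [//|x u] f sN [uk] sab /andP[xab uab] f0.
rewrite iterD; set h := iter n J f.
have h0 v : 0 <= h v by exact: iter_jump_op_ge0.
have Jh0 v : 0 <= J h v by exact: jump_op_ge0.
have b3 : (b <= 3 * b)%R by lra.
have wide := @inboxW _ a b a (3 * b)%R _ (lexx a) b3.
rewrite -cat_rcons; apply: le_trans (IH _ _ _ _ _ _ _ Jh0); last 4 first.
- by rewrite size_rcons addSnnS.
- by [].
- by apply: wide; rewrite /inbox all_rcons xab.
- exact: wide.
set G := bint a b k.+2 _; have G0 : 0 <= G by exact: bint_ge0.
rewrite EFinM -muleA lee_wpmul2l ?lee_fin ?(ltW c0)//.
have -> : (vol * d)%:E * G =
    \int[mu]_(y in `[b, (2 * b)%R]) bint a (3 * b) k (fun=> d%:E * G).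
  under eq_integral do rewrite bint_cst//.
  rewrite integral_cst//= lebesgue_measure_itv/= lte_fin ltr_pMl// ltr1n.
  rewrite -EFinD (_ : 2 * b - b = b)%R; last by ring.
  by rewrite EFinM -muleA muleC -!muleA -EFinM.
rewrite [leRHS]/=; apply: (@le_trans _ _ (\int[mu]_(y in `[b, (2 * b)%R])
    bint a (3 * b) k (fun v => J h (rcons s x ++ y :: v)))); last first.
  apply: le_integral_subset => [y _|]; first exact: bint_ge0.
  by apply: subset_itv; rewrite bnd_simp//; lra.
apply: nonneg_le_integral => [y _|y /=].
  by apply: bint_ge0 => v; rewrite mule_ge0// lee_fin ltW.
rewrite in_itv/= => yb; apply: le_bint => [v|v vk vab].
  by rewrite mule_ge0// lee_fin ltW.
(* The function of the new site [z] is the target integral over the [k.+1] sites to its right. *)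
rewrite cat_rcons; apply: (bulk_minorization _ _ _ _ _ _ _
  (fun z => bint a b k.+1 (fun v => f (s ++ z :: v)))) => //; first exact: ltW.
- by rewrite vk.
- by move=> z; exact: bint_ge0.
(* Second redraw: [z] is frozen, [w :: v] is redrawn in the wider box, and the target box lies
   inside that one. *)
move=> z w zab wab; apply: le_trans (lee_wpmul2l _ (bint_widen _ _ _ _ _ _ _ (lexx a) b3)) _ => //.
  by rewrite lee_fin ltW.
rewrite (_ : (fun v' => f (s ++ z :: v')) = fun v' => f (rcons s z ++ v')); last first.
  by apply/funext => v'; rewrite cat_rcons.
rewrite -cat_rcons; apply: IH => //.
- by rewrite size_rcons addSnnS.
- by rewrite /= vk.
- by apply: wide; rewrite /inbox all_rcons zab.
- by rewrite /= wab.
Qed.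

End minorization.

(** * A box containing [frakC] *)

Section frakC_box.
Context {R : realType}.

(** Since [a_m N 1 = 1], the terms [m = 1] of [V] are the single-site powers, and all other terms
    are nonnegative. *)
Lemma powR_site_le_V (N : nat) (eta : R) (E : seq R) i : (i < N)%N ->
  site E i `^ (eta - 1) <= V N eta E.
Proof.
move=> iN; have N0 : (0 < N)%N by exact: leq_ltn_trans iN.
have inner_ge0 m : 0 <= \sum_(1 <= k < N - m + 2)
    (\sum_(0 <= j < m) site E (k + j).-1) `^ (a_m N m * eta - 1).
  by apply: sumr_ge0 => k _; exact: powR_ge0.
rewrite /V big_ltn// -[leLHS]addr0; apply: lerD; last exact: sumr_ge0.
rewrite (bigD1_seq i.+1) ?iota_uniq//=; last first.
  by rewrite mem_index_iota/= addn2 subn1 prednK// ltnS.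
rewrite big_nat1 addn0 /a_m expr0 subrr mul0r subr0 mul1r lerDl.
by apply: sumr_ge0 => k _; exact: powR_ge0.
Qed.

(** The exponent [eta - 1] is negative, so [V <= M0] keeps each energy away from 0; positivity and
    [W <= M1] bound it above. *)
Lemma frakC_inbox (N : nat) (eta M0 M1 : R) (E : N.-tuple R) : eta < 1 -> 0 < M0 ->
  frakC N eta M0 M1 E -> inbox (M0^-1 `^ (1 - eta)^-1) M1 E.
Proof.
move=> eta1 M00 [Epos [VM WM]]; apply/allP => x xE.
have pos y : y \in tval E -> 0 < y.
  by move=> /(nthP 0)[i]; rewrite size_tuple => iN <-; exact: Epos.
apply/andP; split; last first.
  apply: le_trans WM; rewrite /W (big_rem x xE)/= lerDl big_seq.
  by apply: sumr_ge0 => y /mem_rem /pos /ltW.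
have eta0 : 0 < 1 - eta by rewrite subr_gt0.
have x0 := pos _ xE; have [i] := nthP 0 xE; rewrite size_tuple => iN xi.
have := le_trans (powR_site_le_V _ eta E _ iN) VM.
rewrite /site xi -opprB powRN => xM.
have -> : x = (x `^ (1 - eta)) `^ (1 - eta)^-1.
  by rewrite -powRrM mulfV ?gt_eqF// powRr1// ltW.
apply: ge0_ler_powR; rewrite ?nnegrE ?powR_ge0 ?invr_ge0 ?(ltW eta0) ?(ltW M00)//.
by rewrite -[leRHS]invrK lef_pV2 ?posrE ?invr_gt0 ?powR_gt0.
Qed.

End frakC_box.

(** * From the box to the uniform measure and the Poisson series *)

Theorem theorem6p1 (R : realType) (N : nat) (TL TR K eta M0 M1 t : R) :
  (1 <= N)%N -> 0 < TL -> 0 < TR -> 0 < K ->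
  0 < eta -> eta < 1 -> 1 < M0 -> 1 < M1 ->
  (0 < lebN N (frakC N eta M0 M1))%E ->
  0 < t ->
  exists kappa : R, 0 < kappa /\
    forall E : N.-tuple R, frakC N eta M0 M1 E ->
    forall A : set (N.-tuple R), measurable A ->
      (kappa%:E * unifC N eta M0 M1 A <= Pt N TL TR K t E A)%E.
Proof.
move=> N0 TL0 TR0 K0 _ eta1 M01 M11 _ t0.
have M00 : 0 < M0 by exact: lt_trans M01.
set C := frakC N eta M0 M1.
(* The minimum with 1 ensures [a <= M1]. *)
pose a := Num.min 1 (M0^-1 `^ (1 - eta)^-1).
have a0 : 0 < a by rewrite lt_min ltr01 powR_gt0// invr_gt0.
have aM : a <= M1 by rewrite ge_min ltW.
have CE E : C E -> inbox a M1 E.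
  by move=> /(frakC_inbox _ _ _ _ _ eta1 M00); apply: inboxW; rewrite ?ge_min ?lexx ?orbT.
have [n [c [c0 minor]]] := last_sites_minorization N TL TR K N0 TL0 TR0 K0 N a M1 N0 a0 aM.
pose w := poisson_w N K t n.
have w_ge0 m : 0 <= poisson_w N K t m.
  by rewrite /poisson_w divr_ge0// mulr_ge0 ?expR_ge0// exprn_ge0// mulr_ge0 ?ltW// Lam_gt0.
have w0 : 0 < w.
  rewrite /w /poisson_w divr_gt0 ?ltr0n ?fact_gt0// mulr_gt0 ?expR_gt0//.
  by rewrite exprn_gt0// mulr_gt0// Lam_gt0.
pose z := (fine (lebN N C))^-1.
have z0 : 0 <= z by rewrite invr_ge0 fine_ge0// iint_ge0// => s; rewrite lee_fin.
(* The normalization [z] is absorbed through [z / (z + 1) <= 1], with a denominator that cannot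
   vanish. *)
exists (w * c / (z + 1)); split; first by rewrite divr_gt0 ?ltr_wpDl// mulr_gt0.
move=> E EC A _.
pose f s : \bar R := (\1_(tup_set N A) s)%:E.
have f0 s : (0 <= f s)%E by rewrite lee_fin.
have B0 := bint_ge0 a M1 N f f0.
have lebB : (lebN N (A `&` C) <= bint a M1 N f)%E.
  apply: iint_le_bint => [s|s|s sab]; first by rewrite lee_fin.
    rewrite lee_fin ler_nat /tup_set; have [/set_mem[u [Au _] us]|//] := boolP (_ \in _).
    by rewrite mem_set//; exists u.
  rewrite indicE memNset// => -[u [_ Cu] us].
  by move: sab; rewrite -us CE.
have Jf m s : (0 <= iter m (jump_op N TL TR K) f s)%E by exact: iter_jump_op_ge0.
apply: (@le_trans _ _ (w%:E * (c%:E * bint a M1 N f))%E); last first.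
  apply: (@le_trans _ _ (w%:E * iter n (jump_op N TL TR K) f E)%E).
    rewrite lee_wpmul2l ?lee_fin ?(ltW w0)//.
    have := minor [::] E f; rewrite size_tuple; apply => //; exact: CE.
  rewrite /Pt; apply: le_trans (nneseries_lim_ge n.+1 _); last first.
    by move=> m _ _; rewrite mule_ge0// lee_fin.
  rewrite big_nat_recr//= leeDr// sume_ge0// => m _.
  by rewrite mule_ge0// lee_fin.
rewrite /unifC -/C -/z [X in (_ * X <= _)%E]muleC !muleA -!EFinM.
apply: lee_pmul => //; first by rewrite lee_fin mulr_ge0// divr_ge0 ?addr_ge0// mulr_ge0// ltW.
  by apply: iint_ge0 => s; rewrite lee_fin.
rewrite lee_fin mulrAC ler_pdivrMr ?ltr_wpDl// ler_wpM2l ?lerDl//.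
by rewrite mulr_ge0// ltW.
Qed.
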